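(* Let $\frac{r}{s}$ and $\frac{r'}{s'}$ be rational numbers greater than $1$ (with $r,s$ and $r',s'$ coprime positive integers) such that $\frac{r}{s}>\frac{r'}{s'}$, and write $\left[\frac{r}{s}\right]_q=\frac{\mathcal R}{\mathcal S}$, $\left[\frac{r'}{s'}\right]_q=\frac{\mathcal R'}{\mathcal S'}$. Then the polynomial $$\mathcal X_{\frac rs,\frac{r'}{s'}}:=\mathcal R\mathcal S'-\mathcal S\mathcal R'$$ has positive integer coefficients (i.e., every nonzero coefficient is a positive integer).
   Context: $q$ is a formal variable and $[a]_q=1+q+\cdots+q^{a-1}$ for a positive integer $a$. Every rational $r/s>1$ has a unique negative continued fraction expansion $r/s=\llbracket c_1,\ldots,c_k\rrbracket=c_1-\cfrac{1}{c_2-\cfrac{1}{\ddots-\cfrac{1}{c_k}}}$ with integers $c_i\ge 2$. Its $q$-deformation is the rational function $$\left[\tfrac{r}{s}\right]_q:=[c_1]_q-\cfrac{q^{c_1-1}}{[c_2]_q-\cfrac{q^{c_2-1}}{\ddots-\cfrac{q^{c_{k-1}-1}}{[c_k]_q}}},$$ written as $\frac{\mathcal R(q)}{\mathcal S(q)}$ with $\mathcal R,\mathcal S\in\mathbb Z[q]$ coprime and normalized by $\mathcal R(1)=r$, $\mathcal S(1)=s$. *)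

(* Defs.v *)
From mathcomp Require Import all_boot all_order all_algebra.
From mathcomp Require Import zify ring lra.

Set Implicit Arguments.
Unset Strict Implicit.
Unset Printing Implicit Defensive.

Import Order.TTheory GRing.Theory Num.Theory.
Local Open Scope ring_scope.

(* The formal variable q is 'X : {poly int}, and Q(q) is represented as the
   field of fractions of Z[q]. *)

(* The value of [[c_1, ..., c_k]]; the empty sequence is a junk case. *)
Fixpoint ncf_value (c : seq nat) : rat :=
  match c with
  | [::] => 0
  | [:: a] => a%:R
  | a :: c' => a%:R - 1 / ncf_value c'
  end.

Definition ncf_expansion (x : rat) (c : seq nat) : Prop :=
  [/\ c <> [::], all (fun a => 2 <= a)%N c & ncf_value c = x].

Definition qint (a : nat) : {poly int} := \sum_(i < a) 'X^i.

Fixpoint qncf_value (c : seq nat) : {fraction {poly int}} :=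
  match c with
  | [::] => 0
  | [:: a] => tofrac (qint a)
  | a :: c' => tofrac (qint a) - tofrac 'X^(a.-1) / qncf_value c'
  end.

(* f = [x]_q; f is determined by x, see ncf_expansion_unique. *)
Definition is_qrational (x : rat) (f : {fraction {poly int}}) : Prop :=
  exists2 c, ncf_expansion x c & f = qncf_value c.

(* Divisibility in Z[q]. The boolean %| of polydiv is pseudo-divisibility, i.e.
   divisibility over the field of fractions of the coefficients. *)
Definition dvdZq (d P : {poly int}) : Prop := exists u, P = u * d.

Definition coprimeZq (P Q : {poly int}) : Prop :=
  forall d, dvdZq d P -> dvdZq d Q -> d \is a GRing.unit.

(* [r/s]_q = R/S in lowest terms, with R(1) = r and S(1) = s. *)
Definition is_qrational_pair (r s : nat) (R S : {poly int}) : Prop :=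
  [/\ is_qrational (r%:R / s%:R) (tofrac R / tofrac S),
      coprimeZq R S, R.[1] = r%:R & S.[1] = s%:R].

Lemma ncf_value_gt1 (c : seq nat) :
  c <> [::] -> all (fun a => 2 <= a)%N c -> 1 < ncf_value c.
Proof.
elim: c => // a [|b c] IH _ /= /andP[ha hc]; first by rewrite ltr1n.
have h1 : 1 < ncf_value (b :: c) by apply: IH.
change (1 < a%:R - 1 / ncf_value (b :: c)).
have h2 : 1 / ncf_value (b :: c) < 1 by rewrite ltr_pdivrMr ?mul1r; lra.
have : (2 : rat) <= a%:R by rewrite ler_nat.
lra.
Qed.

Lemma ncf_expansion_exists (x : rat) : 1 < x -> exists c, ncf_expansion x c.
Proof.
suff H n (r s : nat) : (s <= n)%N -> (0 < s < r)%N ->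
    exists c, ncf_expansion (r%:R / s%:R) c.
  move=> hx; have nx : 0 < numq x by rewrite numq_gt0; lra.
  have dx := denq_gt0 x; have ex := divq_num_den x.
  have e1 : numq x = `|numq x|%N by rewrite gtz0_abs.
  have e2 : denq x = `|denq x|%N by rewrite gtz0_abs.
  rewrite -ex e1 e2; apply: (H `|denq x|%N) => //.
  have : denq x < numq x.
    rewrite -(ltr_int rat).
    have hd : 0 < (denq x)%:~R :> rat by rewrite ltr0z.
    by move: hx; rewrite -{1}ex ltr_pdivlMr // mul1r.
  lia.
elim: n r s => [|n IH] r s; first by lia.
move=> sn /andP[s0 rs].
have sQ : s%:R != 0 :> rat by rewrite pnatr_eq0 -lt0n.
have [d0|d0] := eqVneq (r %% s)%N 0%N.
  have er : r = (r %/ s * s)%N by lia.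
  exists [:: r %/ s]%N; split=> //=; first by rewrite andbT; nia.
  by rewrite {2}er natrM mulfK.
pose t := (s - r %% s)%N; have ts : (0 < t < s)%N by rewrite /t; lia.
have er : ((r %/ s).+1 * s = r + t)%N by rewrite /t; lia.
have tn : (t <= n)%N by lia.
have [c [c0 cA cv]] := IH s t tn ts.
exists ((r %/ s).+1 :: c); split=> //=.
  by rewrite cA andbT; nia.
case: c c0 cA cv => // b c _ _ cv.
change ((r %/ s).+1%:R - 1 / ncf_value (b :: c) = r%:R / s%:R); rewrite cv.
have tQ : t%:R != 0 :> rat by rewrite pnatr_eq0; lia.
have e : (r %/ s).+1%:R * s%:R = r%:R + t%:R :> rat by rewrite -natrM er natrD.
by apply: (mulIf sQ); rewrite mulrBl e; field; rewrite tQ sQ.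
Qed.

Lemma ncf_expansion_unique (x : rat) (c d : seq nat) :
  ncf_expansion x c -> ncf_expansion x d -> c = d.
Proof.
case=> c0 cA cv [d0 dA dv]; move: dv; rewrite -cv => {x cv}.
pose u (c : seq nat) : rat := if c is [::] then 0 else 1 / ncf_value c.
have uE a s : ncf_value (a :: s) = a%:R - u s.
  by case: s => [|b s] //=; rewrite subr0.
have u01 s : all (fun a => 2 <= a)%N s -> 0 <= u s < 1.
  case: s => [|b s] sA; rewrite /u ?ltr01 ?lexx //.
  have h : 1 < ncf_value (b :: s) by apply: ncf_value_gt1.
  have h0 : 0 <= ncf_value (b :: s) by lra.
  apply/andP; split; first by rewrite divr_ge0.
  by rewrite ltr_pdivrMr ?mul1r //; lra.
elim: c d c0 d0 cA dA => // a c IH [|b d] // _ _.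
rewrite [all _ _]/= [all _ (b :: d)]/= !uE => /andP[_ cA] /andP[_ dA] e.
have /andP[c1 c2] := u01 _ cA; have /andP[d1 d2] := u01 _ dA.
have ab : a = b.
  have h1 : (a < b.+1)%N by rewrite -(ltr_nat rat) -natr1; lra.
  have h2 : (b < a.+1)%N by rewrite -(ltr_nat rat) -natr1; lra.
  lia.
subst b; congr (_ :: _); have {}e : u d = u c by lra.
have up s : s <> [::] -> all (fun a => 2 <= a)%N s -> 0 < u s.
  case: s => // b s _ sA'; rewrite /u.
  have h : 1 < ncf_value (b :: s) by apply: ncf_value_gt1.
  by rewrite divr_gt0 //; lra.
case: c d IH cA dA e {c1 c2 d1 d2} => [|a' c] [|b' d] IH cA dA e //.
- by have := up (b' :: d) ltac:(by []) dA; rewrite e ltxx.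
- by have := up (a' :: c) ltac:(by []) cA; rewrite -e ltxx.
apply: IH => //; apply: invr_inj.
by move: e; rewrite /u !div1r.
Qed.

Lemma qint_at1 (a : nat) : (qint a).[1] = a%:R.
Proof.
rewrite /qint horner_sum (eq_bigr (fun=> 1)); last first.
  by move=> i _; rewrite hornerXn expr1n.
by rewrite sumr_const card_ord.
Qed.

Lemma qint_at0 (a : nat) : (0 < a)%N -> (qint a).[0] = 1.
Proof.
case: a => // a _; rewrite /qint big_ord_recl expr0 hornerD hornerC horner_sum.
by rewrite big1 ?addr0 // => i _; rewrite hornerXn /= exprS mul0r.
Qed.

Lemma dvdZq_XnM (d P : {poly int}) n :
  d.[0] \is a GRing.unit -> dvdZq d ('X^n * P) -> dvdZq d P.
Proof.
move=> d0; elim: n => [|n IH]; first by rewrite expr0 mul1r.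
case=> u e; apply: IH.
have u0 : u.[0] = 0.
  apply: (mulIr d0); rewrite mul0r -hornerM -e.
  by rewrite hornerM hornerXn exprS !mul0r.
have /factor_theorem[v ev] : root u 0 by apply/rootP.
exists v; apply: (mulfI (x := 'X)); first by rewrite polyX_eq0.
by rewrite mulrA -exprS e ev subr0; ring.
Qed.

Lemma is_qrational_pair_exists (r s : nat) :
  (0 < s)%N -> coprime r s -> 1 < r%:R / s%:R :> rat ->
  exists R S, is_qrational_pair r s R S.
Proof.
move=> s0 crs /ncf_expansion_exists[c [c0 cA cv]].
suff [R [S [cRS e [m [n [eR eS cmn [mn ev]]]]] _]] : exists R S,
    [/\ coprimeZq R S, tofrac R / tofrac S = qncf_value c,
        exists m n : nat, [/\ R.[1] = m%:R, S.[1] = n%:R, coprime m n &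
          (0 < n < m)%N /\ ncf_value c = m%:R / n%:R]
      & R.[0] = 1].
  have sQ : s%:R != 0 :> rat by rewrite pnatr_eq0 -lt0n.
  have nQ : n%:R != 0 :> rat by rewrite pnatr_eq0; lia.
  have /eqP : m%:R / n%:R = r%:R / s%:R :> rat by rewrite -ev.
  rewrite eqr_div // -!natrM eqr_nat => /eqP E.
  have ns : n = s.
    apply/eqP; rewrite eqn_dvd; apply/andP; split.
      by rewrite -(@Gauss_dvdr n m) 1?coprime_sym // E dvdn_mull.
    by rewrite -(@Gauss_dvdr s r) 1?coprime_sym // -E dvdn_mull.
  have mr : m = r by move: E; rewrite ns; nia.
  subst m n; exists R, S; split=> //.
  by exists c.
elim: c c0 cA {cv crs s0} => // a [|b c] IH _ cA.
  exists (qint a), 1; split.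
  - move=> d _ [u e]; apply/unitrPr; exists u.
    by rewrite mulrC -e.
  - by rewrite tofrac1 divr1.
  - exists a, 1%N; split; [exact: qint_at1| by rewrite hornerC| exact: coprimen1|].
    by split; [move: cA => /=; lia | rewrite divr1].
  - by apply: qint_at0; move: cA => /=; lia.
have /andP[a2 bA] : (2 <= a)%N && all (fun a => 2 <= a)%N (b :: c) by [].
have [R [S [cRS e [m [n [eR eS cmn [mn ev]]]] R0]]] := IH ltac:(by []) bA.
pose T := qint a * R - 'X^(a.-1) * S; exists T, R.
have T0 : T.[0] = 1.
  rewrite /T hornerD hornerN !hornerM qint_at0 ?R0; last lia.
  by rewrite hornerXn expr0n; case: (a) a2 => [|[|k]] //= _; rewrite mul0r subr0 mulr1.
split=> //.
- move=> d [u eu] [v eR']; apply: cRS; first by exists v.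
  apply: (@dvdZq_XnM _ _ a.-1).
    by apply/unitrPr; exists u.[0]; rewrite mulrC -hornerM -eu.
  exists (qint a * v - u); rewrite mulrBl -eu -mulrA -eR' /T; ring.
- change (tofrac T / tofrac R
    = tofrac (qint a) - tofrac 'X^(a.-1) / qncf_value (b :: c)).
  rewrite -e /T tofracB !tofracM.
  have hR : tofrac R != 0.
    by rewrite tofrac_eq0; apply/eqP => z; move: R0; rewrite z horner0.
  by rewrite mulrBl mulfK // invf_div mulrA.
- exists (a * m - n)%N, m; split=> //.
  + rewrite /T hornerD hornerN !hornerM qint_at1 eR eS hornerXn expr1n mul1r.
    by rewrite -natrM -natrB //; nia.
  + have dm := dvdn_gcdr (a * m - n) m; have dT := dvdn_gcdl (a * m - n) m.
    rewrite /coprime -dvdn1 -(eqP cmn) dvdn_gcd dm /=.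
    have en : n = (a * m - (a * m - n))%N by nia.
    by rewrite [X in (_ %| X)%N]en dvdn_sub // dvdn_mull.
  + split; first by nia.
    change (a%:R - 1 / ncf_value (b :: c) = (a * m - n)%:R / m%:R).
    rewrite ev natrB ?natrM; last by nia.
    have mQ : m%:R != 0 :> rat by rewrite pnatr_eq0; lia.
    have nQ : n%:R != 0 :> rat by rewrite pnatr_eq0; lia.
    by field; rewrite mQ nQ.
Qed.

(* Main.v *)
Require Import Defs.
From mathcomp Require Import all_boot all_order all_algebra.
From mathcomp Require Import zify ring lra.
Import Order.TTheory GRing.Theory Num.Theory.
Local Open Scope ring_scope.

(** Build the pair (R_c, S_c) from a continued fraction c by the recursion
    R_{a::c} = [a]_q R_c - q^(a-1) S_c and S_{a::c} = R_c, starting from (1, 0).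
    By induction S_c and R_c - S_c have nonnegative coefficients.  Comparing two
    expansions, X_{a::c,a::d} = q^(a-1) X_{c,d}, while for b < a
      X_{a::c,b::d} = q^b [a-b-1]_q R_c R_d + q^(a-1) (R_c - S_c) R_d
                      + q^(b-1) R_c S_d,
    whose terms are all nonnegative.  Since some combination of R_c and S_c is a
    power of q and R_c(0) = 1, the pair (R_c, S_c) is in lowest terms, hence is
    the normalized numerator and denominator. *)

Fixpoint qpair (c : seq nat) : {poly int} * {poly int} :=
  if c is a :: c' then
    (qint a * (qpair c').1 - 'X^(a.-1) * (qpair c').2, (qpair c').1)
  else (1, 0).

(* At the empty sequence both [ncf_value] and its inverse are 0, which is the
   right value of the tail: [[::]] stands for infinity. *)
Lemma ncf_value_cons a c : ncf_value (a :: c) = a%:R - (ncf_value c)^-1.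
Proof. by case: c => [|b c] /=; rewrite ?invr0 ?subr0 ?div1r. Qed.

Lemma qncf_value_cons a c :
  qncf_value (a :: c) = tofrac (qint a) - tofrac 'X^(a.-1) / qncf_value c.
Proof. by case: c => [|b c] //=; rewrite invr0 mulr0 subr0. Qed.

Lemma ncf_value_inv_itv c :
  all (leq 2) c -> 0 <= (ncf_value c)^-1 < 1.
Proof.
case: c => [|a c] cA; first by rewrite [ncf_value _]/(0 : rat) invr0 lexx ltr01.
have h : 1 < ncf_value (a :: c) by apply: ncf_value_gt1.
by rewrite invr_ge0 invf_lt1 ?h ?andbT; lra.
Qed.

Lemma qint_add m n : qint (m + n) = qint m + 'X^m * qint n.
Proof.
rewrite /qint big_split_ord /= mulr_sumr; congr (_ + _).
by apply: eq_bigr => i _; rewrite exprD.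
Qed.

Lemma qint1 : qint 1 = 1.
Proof. by rewrite /qint big_ord1. Qed.

Lemma polyOver_nneg_qint n : qint n \is a polyOver (@Num.Def.nneg_num_pred int).
Proof. by apply: rpred_sum => i _; apply: polyOverXn. Qed.

Lemma qpair_nneg c : all (leq 2) c ->
  (qpair c).2 \is a polyOver (@Num.Def.nneg_num_pred int) /\
  (qpair c).1 - (qpair c).2 \is a polyOver (@Num.Def.nneg_num_pred int).
Proof.
elim: c => [|a c IH] /=; first by rewrite subr0 rpred0 rpred1.
case/andP=> a2 /IH[]; move: (qpair c) => [R S] /= S0 RS0.
have R0 : R \is a polyOver (@Num.Def.nneg_num_pred int).
  by rewrite -(subrK S R) rpredD.
split=> //; case: a a2 => [|[|a]] //= _.
(* Here $[a+2]_q = 1 + q[a]_q + q^{a+1}$: the constant term cancels [- R], and the top power absorbs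
   the term in [S]. *)
have -> : qint a.+2 * R - 'X^(a.+1) * S - R
    = 'X * qint a * R + 'X^(a.+1) * (R - S).
  rewrite -(add1n a.+1) qint_add qint1 expr1 -[in qint _](addn1 a) qint_add.
  by rewrite qint1 exprS; ring.
by rewrite rpredD // !rpredM ?polyOverX ?polyOver_nneg_qint ?polyOverXn.
Qed.

Lemma qpair1_nneg c : all (leq 2) c ->
  (qpair c).1 \is a polyOver (@Num.Def.nneg_num_pred int).
Proof.
by case/qpair_nneg=> S0 RS0; rewrite -(subrK (qpair c).2 (qpair c).1) rpredD.
Qed.

Lemma qpair1_at0 c : all (leq 2) c -> (qpair c).1.[0] = 1.
Proof.
elim: c => [|a c IH] /=; first by rewrite hornerC.
case/andP=> a2 /IH R0; rewrite hornerD hornerN !hornerM R0 qint_at0; last lia.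
rewrite hornerXn; case: a a2 => [|[|a]] //= _.
by rewrite exprS !mul0r subr0 mulr1.
Qed.

Lemma qpair1_neq0 c : all (leq 2) c -> (qpair c).1 != 0.
Proof.
by move=> /qpair1_at0 R0; apply/eqP => z; move: R0; rewrite z horner0.
Qed.

Lemma qncf_value_qpair c : all (leq 2) c ->
  qncf_value c = tofrac (qpair c).1 / tofrac (qpair c).2.
Proof.
(* The pair [(1, 0)] gives 1/0, which is 0 by convention and agrees with the junk value at
   [[::]]. *)
elim: c => [|a c IH] cA; first by rewrite /= tofrac0 invr0 mulr0.
have {}cA : all (leq 2) c by case/andP: cA.
have R0 : tofrac (qpair c).1 != 0 by rewrite tofrac_eq0 qpair1_neq0.
rewrite qncf_value_cons IH //= tofracB !tofracM mulrBl mulfK //.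
by rewrite invf_div mulrA.
Qed.

(** Each recursion step is a matrix of determinant $q^{a-1}$, so undoing all steps costs only a
    power of $q$. *)
Lemma qpair_bezout c :
  exists n U V, 'X^n = (qpair c).1 * U - (qpair c).2 * V.
Proof.
elim: c => [|a c [n [U [V e]]]].
  by exists 0, 1, 0; rewrite /= expr0; ring.
exists (a.-1 + n), V, (qint a * V - 'X^(a.-1) * U) => /=.
by rewrite exprD e; ring.
Qed.

(** Comparing inverses lets the empty tail, with inverse 0, act as infinity in the induction. *)
Lemma qpair_cross_nneg c d : all (leq 2) c -> all (leq 2) d ->
  (ncf_value c)^-1 < (ncf_value d)^-1 ->
  (qpair c).1 * (qpair d).2 - (qpair c).2 * (qpair d).1
    \is a polyOver (@Num.Def.nneg_num_pred int).
Proof.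
elim: c d => [|a c IH] d.
  by move=> _ /qpair_nneg[S0 _] _; rewrite /= mul1r mul0r subr0.
move=> acA bdA lt_cd.
have /andP[ac_ge0 _] := ncf_value_inv_itv _ acA.
case: d bdA lt_cd => [_|b d bdA]; first by rewrite /= invr0; lra.
have ac_gt1 : 1 < ncf_value (a :: c) by apply: ncf_value_gt1.
have bd_gt1 : 1 < ncf_value (b :: d) by apply: ncf_value_gt1.
rewrite ltf_pV2 ?posrE; [|lra..].
rewrite !ncf_value_cons.
case/andP: acA => a2 cA; case/andP: bdA => b2 dA.
have /andP[c0 c1] := ncf_value_inv_itv _ cA.
have /andP[d0 d1] := ncf_value_inv_itv _ dA.
move=> lt_dc.
(* The inverse tails lie in $[0,1)$, so the larger value cannot have the smaller head. *)
have ba : (b < a.+1)%N by rewrite -(ltr_nat rat) -natr1; lra.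
have [eab|neab] := eqVneq a b.
  subst b.
  have := IH d cA dA ltac:(lra).
  rewrite /=; move: (qpair c) (qpair d) => [R S] [R' S'] /= X0.
  have -> : (qint a * R - 'X^(a.-1) * S) * R'
     - R * (qint a * R' - 'X^(a.-1) * S')
     = 'X^(a.-1) * (R * S' - S * R') by ring.
  by rewrite rpredM ?polyOverXn.
have [k ea] : exists k, a = (b + k.+1)%N by exists (a - b).-1; lia.
have [S0 RS0] := qpair_nneg _ cA; have R0 := qpair1_nneg _ cA.
have [S'0 _] := qpair_nneg _ dA; have R'0 := qpair1_nneg _ dA.
rewrite /=; move: (qpair c) (qpair d) S0 RS0 R0 S'0 R'0.
move=> [R S] [R' S'] /= S0 RS0 R0 S'0 R'0.
(* Use $[a]_q - [b]_q = q^b[k]_q + q^{b+k}$; since $b+k = a-1$, the last power pairs with the term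
   in [S] to form [R - S]. *)
have -> : (qint a * R - 'X^(a.-1) * S) * R'
     - R * (qint b * R' - 'X^(b.-1) * S')
   = 'X^b * qint k * R * R' + 'X^(b + k) * (R - S) * R' + 'X^(b.-1) * R * S'.
  by rewrite ea addnS /= -addnS -addn1 !qint_add qint1 exprD; ring.
by rewrite !rpredD // !rpredM ?polyOverXn ?polyOver_nneg_qint.
Qed.

(** As [P] is 1 at 0, it has no factor $q$, so [W] must supply every one of them. *)
Lemma Xn_dvd_mul_at0 (P W Q : {poly int}) n :
  P.[0] = 1 -> 'X^n * Q = P * W -> exists W', W = 'X^n * W'.
Proof.
move=> P0; elim: n Q W => [|n IH] Q W e; first by exists W; rewrite mul1r.
have W0 : W.[0] = 0.
  by rewrite -[LHS]mul1r -P0 -hornerM -e hornerM hornerXn exprS !mul0r.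
have /factor_theorem[V eV] : root W 0 by apply/rootP.
have [|W' eW'] := IH Q V.
  apply: (mulfI (x := 'X)); first by rewrite polyX_eq0.
  by rewrite mulrA -exprS e eV subr0; ring.
by exists W'; rewrite eV subr0 eW' exprS; ring.
Qed.

Lemma polyOver_nneg_horner1 (P : {poly int}) :
  P \is a polyOver (@Num.Def.nneg_num_pred int) -> 0 <= P.[1].
Proof. by move=> P0; apply: (rpred_horner P0); apply: rpred1. Qed.

Lemma is_qrational_pairP (r s : nat) (R S : {poly int}) :
  (0 < r)%N -> (0 < s)%N -> is_qrational_pair r s R S ->
  exists c, ncf_expansion (r%:R / s%:R) c /\ (R, S) = qpair c.
Proof.
move=> r0 s0 [[c cE f] cop R1 S1]; exists c; split=> //.
case: cE => cN cA _; have {}cA : all (leq 2) c by [].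
have S_neq0 : S != 0.
  apply/eqP => z; move: S1; rewrite z horner0 => /eqP.
  by rewrite eq_sym pnatr_eq0; lia.
have Sc_neq0 : (qpair c).2 != 0.
  by case: c cN cA {f} => // a c _ /andP[_ cA]; apply: qpair1_neq0.
have Rc_at0 := qpair1_at0 _ cA; have Rc_nneg := qpair1_nneg _ cA.
move/eqP: f; rewrite qncf_value_qpair // eqr_div ?tofrac_eq0 // -!tofracM.
rewrite tofrac_eq => /eqP cross.
have [n [U [V bez]]] := qpair_bezout c.
move: (qpair c) cross bez Sc_neq0 Rc_at0 Rc_nneg.
move=> [Rc Sc] /= cross bez Sc_neq0 Rc_at0 Rc_nneg.
(* Multiply [bez] by [R] (below, by [S]) and trade [R * Sc] for [Rc * S]. Both products then share
   one cofactor, which is $q^n$ times a common factor [W] of [R] and [S]. *)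
have eR : 'X^n * R = Rc * (R * U - S * V).
  transitivity (Rc * R * U - V * (R * Sc)); first by rewrite bez; ring.
  by rewrite cross; ring.
have eS : 'X^n * S = Sc * (R * U - S * V).
  transitivity (U * (Rc * S) - Sc * S * V); first by rewrite bez; ring.
  by rewrite -cross; ring.
have [W eW] := Xn_dvd_mul_at0 _ _ _ _ Rc_at0 eR.
have Xn0 : 'X^n != 0 :> {poly int} by rewrite expf_neq0 ?polyX_eq0.
have {}eR : R = W * Rc by apply: (mulfI Xn0); rewrite eR eW; ring.
have {}eS : S = W * Sc by apply: (mulfI Xn0); rewrite eS eW; ring.
have : W \is a GRing.unit.
  by apply: cop; [exists Rc; rewrite mulrC|exists Sc; rewrite mulrC].
rewrite poly_unitE => /andP[/eqP sW W0].
have eWC : W = (W`_0)%:P by apply: size1_polyC; rewrite sW.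
move: W0 eWC; rewrite unfold_in => /orP[]/eqP-> eWC.
  by rewrite eR eS eWC !mul1r.
(* Only [W = -1] remains; it would make [R.[1]] nonpositive, against [R.[1] = r > 0]. *)
have Rc1 := polyOver_nneg_horner1 _ Rc_nneg.
have : 0 < R.[1] by rewrite R1 ltr0n.
by rewrite eR eWC hornerM hornerC mulN1r oppr_gt0 ltNge Rc1.
Qed.

Theorem theorem1p5 (r s r' s' : nat) (R S R' S' : {poly int})
  (hr : (0 < r)%N) (hs : (0 < s)%N) (hrs : coprime r s)
  (hr' : (0 < r')%N) (hs' : (0 < s')%N) (hrs' : coprime r' s')
  (h1 : 1 < r%:R / s%:R :> rat) (h1' : 1 < r'%:R / s'%:R :> rat)
  (hgt : r%:R / s%:R > r'%:R / s'%:R :> rat)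
  (hRS : is_qrational_pair r s R S)
  (hRS' : is_qrational_pair r' s' R' S') :
  forall i : nat, (R * S' - S * R')`_i != 0 -> 0 < (R * S' - S * R')`_i.
Proof.
have [c [[_ cA cv] ec]] := is_qrational_pairP _ _ _ _ hr hs hRS.
have [d [[_ dA dv] ed]] := is_qrational_pairP _ _ _ _ hr' hs' hRS'.
have lt_cd : (ncf_value c)^-1 < (ncf_value d)^-1.
  by rewrite cv dv ltf_pV2 // posrE; lra.
have := qpair_cross_nneg _ _ cA dA lt_cd.
rewrite -ec -ed /= => /polyOverP X0 i Xi.
by rewrite lt0r Xi; apply: X0.
Qed.
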